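(* Let $G$ be a finitely generated abelian group, let $S=S^{-1}$ be a finite generating set of $G$, and let $d$ be the graph metric of the Cayley graph of $G$ with respect to $S$. Then every point of the metric boundary $\partial_d G$ is a Busemann point.
   Context: The Cayley graph of $G$ with respect to $S$ has vertex set $G$ and undirected edges joining $g$ and $gs$ for $g\in G$, $s\in S$. For a connected graph, the graph metric $d$ on the vertices is $d(x,y)=$ the minimum length (number of edges) of a path from $x$ to $y$. Metric compactification: for a complete, locally compact metric space $(X,d)$, let $C_b(X)$ be the commutative unital C*-algebra of bounded continuous functions on $X$ with the uniform norm, and $C_\infty(X)$ the closed subalgebra of functions vanishing at infinity. For $y,z\in X$ let $\varphi_{y,z}(x)=d(x,y)-d(x,z)$, which lies in $C_b(X)$. Let $\mathcal{G}(X,d)$ be the closed (C*-)subalgebra of $C_b(X)$ generated by $C_\infty(X)$, the constant functions and all $\varphi_{y,z}$, $y,z\in X$. The metric compactification $\overline{X}_d$ is the maximal ideal space (Gelfand spectrum) of $\mathcal{G}(X,d)$; it is compact and contains $X$ as an open subset via point evaluations. The metric boundary is $\partial_d X=\overline{X}_d\setminus X$. Here it is applied to $X=G$ with the Cayley graph metric. Let $T$ be an unbounded subset of $\mathbb{R}^+=[0,\infty)$ containing $0$. A map $\gamma:T\to X$ is an almost-geodesic ray if for every $\varepsilon>0$ there is an integer $N$ such that $|d(\gamma(t),\gamma(s))+d(\gamma(s),\gamma(0))-t|<\varepsilon$ for all $t,s\in T$ with $t\ge s\ge N$. The ray $\gamma$ converges to $\omega\in\partial_d X$ if $\gamma(t)\to\omega$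 in $\overline{X}_d$ as $t\to\infty$ in $T$. A point of $\partial_d X$ is a Busemann point if it is the limit of an almost-geodesic ray. *)

(* Defs.v *)
From HB Require Import structures.
From mathcomp Require Import all_boot all_order all_algebra finmap.
From mathcomp Require Import all_classical all_reals all_analysis.
From mathcomp Require Import complex.

Set Implicit Arguments.
Unset Strict Implicit.
Unset Printing Implicit Defensive.

Import Order.TTheory GRing.Theory Num.Theory numFieldNormedType.Exports.

Local Open Scope classical_set_scope.
Local Open Scope ring_scope.

Section graph_distance.
Context {V : choiceType}.
Implicit Types (e : rel V) (x y : V).

Definition walk e x y (n : nat) : Prop :=
  exists p : seq V, [/\ path e x p, last x p = y & size p = n].

(* The value 0 for disconnected pairs is junk. *)
Definition graph_dist e x y : nat :=
  if pselect (exists n, `[< walk e x y n >]) is left h then ex_minn h else 0.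

Lemma graph_distP e x y : (exists n, walk e x y n) ->
  walk e x y (graph_dist e x y) /\
  (forall n, walk e x y n -> (graph_dist e x y <= n)%N).
Proof.
move=> [n xyn]; rewrite /graph_dist; case: pselect => [h|[]]; last first.
  by exists n; apply/asboolP.
by case: ex_minnP => m /asboolP xym mmin; split=> // k /asboolP /mmin.
Qed.

Lemma walk_cat e x y z m n : walk e x y m -> walk e y z n -> walk e x z (m + n).
Proof.
move=> [p [px <- <-]] [q [qx <- <-]]; exists (p ++ q).
by rewrite cat_path px qx last_cat size_cat.
Qed.

Lemma walk_sym e x y n : symmetric e -> walk e x y n -> walk e y x n.
Proof.
move=> esym [p [px <- <-]]; exists (rev (belast x p)).
split; first by rewrite rev_path; apply: sub_path px => u v; rewrite esym.
  by case: p {px} => //= a p; rewrite rev_cons last_rcons.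
by rewrite size_rev size_belast.
Qed.

Variables (e : rel V) (esym : symmetric e).
Hypothesis econn : forall x y, exists n, walk e x y n.

Lemma graph_distxx x : graph_dist e x x = 0%N.
Proof.
have [_ /(_ 0%N)] := graph_distP (econn x x).
by rewrite leqn0 => H; apply/eqP/H; exists [::].
Qed.

Lemma graph_dist0_eq x y : graph_dist e x y = 0%N -> x = y.
Proof.
move=> d0; have [] := graph_distP (econn x y).
by rewrite d0 => -[[|a p] [_ <- //]].
Qed.

Lemma graph_distC x y : graph_dist e x y = graph_dist e y x.
Proof.
have [xy xym] := graph_distP (econn x y).
have [yx yxm] := graph_distP (econn y x).
by apply/eqP; rewrite eqn_leq xym ?yxm//; apply: walk_sym.
Qed.

Lemma graph_dist_triangle y x z :
  (graph_dist e x z <= graph_dist e x y + graph_dist e y z)%N.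
Proof.
have [xy _] := graph_distP (econn x y).
have [yz _] := graph_distP (econn y z).
by have [_] := graph_distP (econn x z); apply; apply: walk_cat xy yz.
Qed.

End graph_distance.

Section cayley.
Context {G : zmodType}.
Implicit Type S : {fset G}.

Definition symmetric_fset S := [fset - s | s in S]%fset = S.

Definition generates S :=
  forall H : {pred G}, zmod_closed H -> {subset S <= H} -> H =i predT.

(* x and y are joined by an edge iff {x, y} = {g, g + s} for some g and some
   s in S. *)
Definition cayley_edge S : rel G := fun x y => (y - x \in S) || (x - y \in S).

Lemma cayley_edge_sym S : symmetric (cayley_edge S).
Proof. by move=> x y; rewrite /cayley_edge orbC. Qed.

Lemma cayley_connected S : generates S ->
  forall x y, exists n, walk (cayley_edge S) x y n.
Proof.
move=> Sgen x y.
pose H : {pred G} := fun g => `[< exists n, walk (cayley_edge S) 0 g n >].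
have walkD a u v n : walk (cayley_edge S) u v n ->
    walk (cayley_edge S) (a + u) (a + v) n.
  move=> [p [pu <- <-]]; exists (map (+%R a) p).
  rewrite size_map last_map path_map; split=> //.
  apply: sub_path pu => b c /=; rewrite /cayley_edge.
  have aK g h : a + g - (a + h) = g - h by rewrite opprD addrACA subrr add0r.
  by rewrite !aK.
have Hclosed : zmod_closed H.
  split=> [|u v /asboolP[m um] /asboolP[n vn]]; apply/asboolP.
    by exists 0%N, [::].
  exists (n + m)%N.
  have vu : walk (cayley_edge S) v u (n + m).
    exact: walk_cat (walk_sym (@cayley_edge_sym S) vn) um.
  by have := walkD (- v) _ _ _ vu; rewrite addNr addrC.
have SH : {subset S <= H}.
  move=> s sS; apply/asboolP; exists 1%N, [:: s]; split=> //=.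
  by rewrite /cayley_edge subr0 sS.
have /asboolP[n yxn] : y - x \in H by rewrite (Sgen H Hclosed SH).
exists n; have := walkD x _ _ _ yxn.
by rewrite addr0 addrCA subrr addr0.
Qed.

End cayley.

(* The group G as a metric space over R, with the graph metric of its Cayley
   graph. *)
Definition cayley_space (R : realType) (G : zmodType) (S : {fset G})
  (Ssym : symmetric_fset S) (Sgen : generates S) : Type := G.

Section cayley_metric.
Variables (R : realType) (G : zmodType) (S : {fset G}).
Variables (Ssym : symmetric_fset S) (Sgen : generates S).
Local Notation X := (cayley_space R Ssym Sgen).

HB.instance Definition _ := Choice.copy X G.

Definition cayley_dist (x y : X) : R :=
  (graph_dist (cayley_edge S) (x : G) (y : G))%:R.

Let connS := cayley_connected Sgen.
Let symS := @cayley_edge_sym _ S.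

Lemma cayley_distxx x : cayley_dist x x = 0.
Proof. by rewrite /cayley_dist graph_distxx. Qed.

Lemma cayley_dist0_eq x y : cayley_dist x y = 0 -> x = y.
Proof. by move/eqP; rewrite pnatr_eq0 => /eqP/(graph_dist0_eq connS). Qed.

Lemma cayley_distC x y : cayley_dist x y = cayley_dist y x.
Proof. by rewrite /cayley_dist (graph_distC symS connS). Qed.

Lemma cayley_dist_triangle y x z :
  cayley_dist x z <= cayley_dist x y + cayley_dist y z.
Proof. by rewrite -natrD ler_nat (graph_dist_triangle connS). Qed.

HB.instance Definition _ := @isMetric.Build R X cayley_dist
  cayley_distxx cayley_dist0_eq cayley_distC cayley_dist_triangle.

End cayley_metric.

Section metric_algebra.
Context {R : realType} (X : metricType R).
Local Notation C := (R[i]^o).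

Definition bounded_continuous : set (X -> C) :=
  [set f | continuous f /\ bounded_fun f].

Definition vanishing_at_infinity : set (X -> C) :=
  [set f | continuous f /\ forall eps : R[i], 0 < eps ->
    exists2 K : set X, compact K & forall x, ~ K x -> `|f x| < eps].

Definition dist_diff (y z : X) : X -> C :=
  fun x => real_complex R (mdist x y - mdist x z).

(* The uniform structure on {uniform X -> C} is that of uniform convergence,
   whose restriction to bounded functions is the sup-norm topology. *)
Record cstar_subalgebra (A : set (X -> C)) : Prop := CstarSubalgebra {
  cstar_sub : A `<=` bounded_continuous ;
  cstar_linear : forall (k : R[i]) f g, A f -> A g -> A (k *: f + g) ;
  cstar_mul : forall f g, A f -> A g -> A (f * g) ;
  cstar_conj : forall f, A f -> A (fun x => conjc (f x)) ;
  cstar_closed : closed (A : set {uniform X -> C})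
}.

Definition metric_generators : set (X -> C) :=
  vanishing_at_infinity `|` range (@cst X C)
  `|` [set dist_diff y z | y in [set: X] & z in [set: X]].

Definition metric_algebra : {pred X -> C} :=
  mem (smallest cstar_subalgebra metric_generators).

Lemma metric_algebra_cst (c : C) : (cst c : X -> C) \in metric_algebra.
Proof.
by rewrite inE => A [_ genA]; apply: genA; left; right; exists c.
Qed.

Lemma metric_algebra_linear (k : R[i]) (f g : X -> C) :
  f \in metric_algebra -> g \in metric_algebra ->
  k *: f + g \in metric_algebra.
Proof.
rewrite !inE => Af Ag B sB; have [cB _] := sB.
by apply: (cstar_linear cB); [apply: Af|apply: Ag].
Qed.

Lemma metric_algebra_subring_closed : subring_closed metric_algebra.
Proof.
split=> [|f g Af Ag|f g]; first exact: metric_algebra_cst.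
  by rewrite addrC -scaleN1r metric_algebra_linear.
rewrite !inE => Af Ag B sB; have [cB _] := sB.
by apply: (cstar_mul cB); [apply: Af|apply: Ag].
Qed.

Lemma metric_algebra_scaler_closed : scaler_closed metric_algebra.
Proof.
move=> k f Af; rewrite -[_ *: f]addr0 metric_algebra_linear//.
exact: metric_algebra_cst.
Qed.

HB.instance Definition _ := GRing.isSubringClosed.Build (X -> C)
  metric_algebra metric_algebra_subring_closed.
HB.instance Definition _ := GRing.isScaleClosed.Build R[i] (X -> C)
  metric_algebra metric_algebra_scaler_closed.

Definition metric_function := {f : X -> C | f \in metric_algebra}.

HB.instance Definition _ := SubChoice.on metric_function.
HB.instance Definition _ := GRing.SubChoice_isSubComPzRing.Build _ _
  metric_function (subringClosedP metric_algebra).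
HB.instance Definition _ := [SubZmodule_isSubLmodule of metric_function by <:].

End metric_algebra.

Section metric_compactification.
Context {R : realType} (X : metricType R).
Local Notation C := (R[i]^o).

Record metric_compactification := Character {
  character_fun :> metric_function X -> C ;
  character_linear : linear character_fun ;
  character_mul : forall f g,
    character_fun (f * g) = character_fun f * character_fun g ;
  character_neq0 : exists f, character_fun f != 0
}.

HB.instance Definition _ := gen_eqMixin metric_compactification.
HB.instance Definition _ := gen_choiceMixin metric_compactification.

(* The Gelfand (weak-* ) topology: pointwise convergence on metric_function. *)
HB.instance Definition _ := Topological.copy metric_compactification
  (initial_topology
    (character_fun : metric_compactification -> {ptws metric_function X -> C})).

Lemma point_eval_linear (x : X) : linear (fun f : metric_function X => val f x).
Proof. by []. Qed.

Lemma point_eval_mul (x : X) (f g : metric_function X) :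
  val (f * g) x = val f x * val g x.
Proof. by []. Qed.

Lemma point_eval_neq0 (x : X) : exists f : metric_function X, val f x != 0 :> C.
Proof. by exists 1; exact: oner_neq0. Qed.

Definition point_eval (x : X) : metric_compactification :=
  Character (point_eval_linear x) (point_eval_mul x) (point_eval_neq0 x).

Definition metric_boundary : set metric_compactification :=
  ~` range point_eval.

(* Rays are total functions of which only the values on T matter. *)
Definition almost_geodesic_ray (T : set R) (g : R -> X) : Prop :=
  [/\ T `<=` [set t | 0 <= t], T 0, ~ has_ubound T &
    forall eps : R, 0 < eps -> exists N : int,
      forall t s, T t -> T s -> s <= t -> N%:~R <= s ->
        `|mdist (g t) (g s) + mdist (g s) (g 0) - t| < eps].

Definition ray_converges (T : set R) (g : R -> X)
    (w : metric_compactification) : Prop :=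
  point_eval (g t) @[t --> within T +oo] --> w.

Definition busemann_point (w : metric_compactification) : Prop :=
  metric_boundary w /\ exists (T : set R) (g : R -> X),
    almost_geodesic_ray T g /\ ray_converges T g w.

End metric_compactification.

(* Main.v *)
From HB Require Import structures.
Require Import Defs.
From mathcomp Require Import all_boot all_order all_algebra finmap.
From mathcomp Require Import all_classical all_reals all_analysis.
From mathcomp Require Import complex.

(** A character [w] of the algebra [A] of the metric compactification is
    approximated by point evaluations on any finite family [fs] in [A]
    ([character_approx]): otherwise the sum of the [`|f - w f| ^+ 2], [f] in
    [fs], would be bounded below by a positive constant, hence invertible in [A]
    by the Neumann series ([metric_algebra_inv]), although [w] kills it.  When
    the space is discrete and [w] is a boundary point, [w] kills all point
    masses ([boundary_point_mass]), since a character that does not kill the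
    mass at [x] is evaluation at [x].  Adding point masses to the family pushes
    the approximating points out of any finite set; so in the Cayley graph there
    are points [x n], going to infinity, along which each difference of distance
    functions tends to its value at [w] ([boundary_approx]).

    Commutativity enters through Dickson's lemma.  Write each [x n] as a
    geodesic word over [S].  In an abelian group only the number of occurrences
    of each letter matters, that is, a vector of natural numbers indexed by the
    finite set [S], and along a subsequence these vectors increase
    coordinatewise ([dickson_subseq]).  If the word of [x m] is contained, with
    multiplicities, in the word of [x n], then the remaining letters lead from
    [x m] to [x n], so [x m] lies on a geodesic from [0] to [x n]
    ([geodesic_word_cat]).  The subsequence therefore lies on one geodesic ray
    from [0]: parametrized by the distance to [0], it satisfies the
    almost-geodesic condition with error zero.

    This ray converges to [w].  The functions of [A] whose values along it tend
    to their value at [w] form a C*-subalgebra ([converging_cstar_subalgebra]).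
    It contains the constants, the differences of distance functions by the
    choice of [x], and the functions vanishing at infinity, because the ray
    leaves compact sets and a boundary point kills these functions
    ([boundary_vanishing]).  So it is all of [A]. *)

Set Implicit Arguments.
Unset Strict Implicit.
Unset Printing Implicit Defensive.

Import Order.TTheory GRing.Theory Num.Theory numFieldNormedType.Exports.

Local Open Scope classical_set_scope.
Local Open Scope ring_scope.

(** * The metric algebra as a C*-algebra of bounded continuous functions *)

Lemma continuous_normP {R : realType} (T : topologicalType) (f : T -> R[i]^o) :
  continuous f <->
  forall x (e : R[i]), 0 < e -> \forall y \near x, `|f x - f y| < e.
Proof.
split=> fc x; first by apply/cvgrPdist_lt; exact: fc.
by apply/cvgrPdist_lt; exact: fc.
Qed.

Lemma split_third (K : numFieldType) (e : K) :
  e = e / 3%:R + e / 3%:R + e / 3%:R.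
Proof.
rewrite -!mulrDl; apply: (canRL (mulfK _)); first by rewrite pnatr_eq0.
by rewrite mulr_natr !mulrSr mulr0n add0r.
Qed.

Section uniform_closure.
Context {R : realType} {X : metricType R}.
Local Notation C := (R[i]^o).

Lemma uniform_nbhs_norm (f : X -> C) (e : C) : 0 < e ->
  nbhs (f : {uniform X -> C}) [set g | forall x, `|f x - g x| < e].
Proof.
move=> e0; apply/uniform_nbhs.
exists [set xy : C * C | `|xy.1 - xy.2| < e]; split.
  by rewrite -entourage_ballE; exists e.
by move=> g /= fg x; apply: fg.
Qed.

Lemma uniform_closedP (A : set (X -> C)) :
  closed (A : set {uniform X -> C}) <->
  forall f : X -> C,
    (forall e : C, 0 < e -> exists2 g, A g & forall x, `|f x - g x| < e) -> A f.
Proof.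
split=> [Acl f fA|Acl f fA].
  apply: Acl => B /uniform_nbhs [E [entE EB]].
  move: entE; rewrite -entourage_ballE => -[e /= e0 eE].
  have [g Ag fg] := fA _ e0; exists g; split => //; apply: EB => x _.
  by apply: eE; apply: fg.
apply: Acl => e e0; have [g [Ag fg]] := fA _ (uniform_nbhs_norm f e0).
by exists g.
Qed.

Lemma bounded_continuousP (f : X -> C) :
  bounded_continuous f <->
  continuous f /\ exists2 M : C, 0 < M & forall x, `|f x| < M.
Proof.
split=> -[fc fb]; split=> //.
  by have [M M0 fM] := ex_strict_bound_gt0 fb; exists M => // x; apply: fM.
have [M M0 fM] := fb; exists M; split; first exact: gtr0_real.
by move=> N MN x _; apply: ltW; exact: lt_trans MN.
Qed.

(** [metric_algebra] is an intersection over all C*-subalgebras that contain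
    the generators; this lemma and the next three provide one such subalgebra,
    without which the intersection would be the set of all functions. *)
Lemma cstar_subalgebra_bounded_continuous :
  cstar_subalgebra (@bounded_continuous R X).
Proof.
split=> //.
- move=> k f g /bounded_continuousP[fc [M M0 fM]].
  move=> /bounded_continuousP[gc [N N0 gN]]; apply/bounded_continuousP; split.
    move=> x; apply: (@cvgD _ C); last exact: gc.
    by apply: (@cvgZr _ C); exact: fc.
  exists (`|k| * M + N); first by rewrite ltr_wpDl// mulr_ge0// ltW.
  move=> x; apply: le_lt_trans (ler_normD _ _) _; apply: ler_ltD => //.
  by rewrite normrM ler_wpM2l// ltW.
- move=> f g /bounded_continuousP[fc [M M0 fM]].
  move=> /bounded_continuousP[gc [N N0 gN]]; apply/bounded_continuousP; split.
    by move=> x; apply: cvgM; [exact: fc|exact: gc].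
  exists (M * N); first exact: mulr_gt0.
  by move=> x; rewrite normrM ltr_pM.
- move=> f /bounded_continuousP[fc [M M0 fM]].
  apply/bounded_continuousP; split.
    apply/continuous_normP => x e e0.
    near=> y; rewrite -rmorphB normcJ; near: y.
    by move/continuous_normP: fc; apply.
  by exists M => // x; rewrite normcJ.
- apply/uniform_closedP => f fA; apply/bounded_continuousP; split; last first.
    have [g /bounded_continuousP[_ [M M0 gM]] fg] := fA 1 ltr01.
    exists (1 + M); first exact: addr_gt0.
    move=> x; rewrite -(subrK (g x) (f x)).
    by apply: le_lt_trans (ler_normD _ _) _; apply: ltrD.
  apply/continuous_normP => x e e0.
  have e3 : 0 < e / 3%:R by rewrite divr_gt0.
  have [g [gc _] fg] := fA _ e3; near=> y.
  have -> : f x - f y = (f x - g x) + (g x - g y) - (f y - g y).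
    by rewrite addrA subrK opprB addrA subrK.
  rewrite [ltRHS]split_third.
  apply: le_lt_trans (ler_normB _ _) _; apply: ltrD; last exact: fg.
  apply: le_lt_trans (ler_normD _ _) _; apply: ltrD; first exact: fg.
  by near: y; move/continuous_normP: gc; apply.
Unshelve. all: by end_near. Qed.

Lemma vanishing_bounded_continuous :
  @vanishing_at_infinity R X `<=` @bounded_continuous R X.
Proof.
move=> f [fc fv]; apply/bounded_continuousP; split=> //.
have [K /compact_near_coveringP cK fK] := fv 1 ltr01.
(* A bound for [f] near each point of [K] gives, by compactness, a bound valid
   on all of [K]. *)
have : \forall M \near (+oo : set_system C), K `<=` (fun x => `|f x| < M).
  apply: cK => x Kx; near=> y M => /=.
  apply: (@lt_trans _ _ (`|f x| + 1)); last first.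
    near: M; exists (`|f x| + 1); split=> //; exact: ger0_real.
  rewrite -(subrK (f x) (f y)) addrC.
  apply: le_lt_trans (ler_normD _ _) _; rewrite ltrD2l distrC; near: y.
  by move/continuous_normP: fc; apply.
move=> /pinfty_ex_gt0[M M0 fM]; exists (M + 1); first exact: addr_gt0.
move=> x; have [Kx|/fK fx] := pselect (K x).
  by apply: lt_trans (fM x Kx) _; rewrite ltrDl.
by apply: lt_trans fx _; rewrite ltrDr.
Unshelve. all: by end_near. Qed.

Lemma dist_diff_bounded_continuous (y z : X) :
  bounded_continuous (dist_diff y z : X -> C).
Proof.
have lip (u v w : X) : `|mdist u w - mdist v w| <= mdist u v.
  rewrite ler_distl lerBlDl (metric_sym u v) metric_triangle /=.
  by rewrite addrC (metric_sym v u) metric_triangle.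
apply/bounded_continuousP; split.
  apply/continuous_normP => x e e0.
  have /complex_realP[e' ee'] : e \is Num.real by exact: gtr0_real.
  move: e0; rewrite ee' -[0]/(real_complex R 0) ltcR => e0.
  near=> t; rewrite /dist_diff -rmorphB normc_def /= expr0n addr0 sqrtr_sqr.
  rewrite ltcR.
  have -> : mdist x y - mdist x z - (mdist t y - mdist t z) =
     (mdist x y - mdist t y) - (mdist x z - mdist t z).
    by rewrite !opprB addrACA [RHS]addrACA; congr (_ + _); exact: addrC.
  apply: le_lt_trans (ler_normB _ _) _.
  apply: (@le_lt_trans _ _ (mdist x t + mdist x t)).
    by rewrite lerD.
  have xt : mdist x t < e' / 2.
    near: t; have := @nbhsx_ballx _ _ x (e' / 2) (divr_gt0 e0 (ltr0n _ 2)).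
    by rewrite ballEmdist.
  by rewrite [ltRHS](splitr e') ltrD.
exists (real_complex R (mdist y z + 1)).
  by rewrite -[0]/(real_complex R 0) ltcR ltr_wpDl// mdist_ge0.
move=> x; rewrite normc_def /= expr0n addr0 sqrtr_sqr ltcR.
by rewrite ![mdist x _]metric_sym (le_lt_trans (lip _ _ _))// ltrDl.
Unshelve. all: by end_near. Qed.

Lemma metric_generators_bounded_continuous :
  @metric_generators R X `<=` @bounded_continuous R X.
Proof.
move=> f [[|[c _ <-]]|[y _ [z _ <-]]].
- exact: vanishing_bounded_continuous.
- apply/bounded_continuousP; split; first by move=> x; exact: cvg_cst.
  by exists (`|c| + 1) => [|x]; [rewrite ltr_wpDl|rewrite ltrDl].
- exact: dist_diff_bounded_continuous.
Qed.

Lemma cstar_subalgebra_metric_algebra :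
  cstar_subalgebra [set f | f \in @metric_algebra R X].
Proof.
split.
- move=> f; rewrite /= inE; apply; split.
    exact: cstar_subalgebra_bounded_continuous.
  exact: metric_generators_bounded_continuous.
- by move=> k f g /=; exact: metric_algebra_linear.
- by move=> f g /= fA gA; exact: rpredM.
- move=> f; rewrite /= !inE => fA B sB.
  by apply: cstar_conj sB.1 _ _; apply: fA.
- apply/uniform_closedP => f fA; rewrite /= inE => B sB.
  apply/(uniform_closedP B).1; first exact: cstar_closed sB.1.
  move=> e /fA[g]; rewrite /= inE => gA fg; exists g => //.
  exact: gA.
Qed.

Lemma metric_generators_algebra (f : X -> C) :
  metric_generators f -> f \in @metric_algebra R X.
Proof. by move=> fg; rewrite inE => A [_]; apply. Qed.

End uniform_closure.

(** * Characters are limits of point evaluations *)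

Section characters.
Context {R : realType} {X : metricType R}.
Local Notation C := (R[i]^o).

Lemma complex_expr_small (q d : C) : 0 <= q -> q < 1 -> 0 < d ->
  exists n, q ^+ n < d.
Proof.
move=> q0 q1 d0.
have /complex_realP[q' qq'] : q \is Num.real by exact: ger0_real.
have /complex_realP[d' dd'] : d \is Num.real by exact: gtr0_real.
move: q0 q1 d0; rewrite qq' dd' -[0]/(real_complex R 0) -[1]/(real_complex R 1).
rewrite lecR !ltcR => q0 q1 d0.
have q1' : `|q'| < 1 by rewrite ger0_norm.
have /cvgrPdist_lt/(_ _ d0)[n _ /(_ n (leqnn n))] := cvg_expr q1'.
rewrite sub0r normrN normrX ger0_norm// => qn.
by exists n; rewrite -rmorphXn ltcR.
Qed.

(** For [e <= h < M], the function [u = 1 - h / M] takes its values in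
    [[0, 1 - e / M]], so the partial sums of [M^-1 * \sum_i u ^+ i] converge
    uniformly to [1 / h], the error at rank [n] being [u ^+ n / h]. *)
Lemma metric_algebra_inv (h : X -> C) (e : C) :
  h \in @metric_algebra R X -> 0 < e -> (forall x, e <= h x) ->
  (fun x => (h x)^-1 : C) \in @metric_algebra R X.
Proof.
move=> hA e0 eh; have cA := @cstar_subalgebra_metric_algebra R X.
have /bounded_continuousP[_ [M M0 hM]] := cstar_sub cA hA.
have h0 x : 0 < h x by exact: lt_le_trans (eh x).
have hleM x : h x <= M by rewrite -[h x]ger0_norm ?ltW.
pose u : X -> C := 1 - M^-1 *: h.
have uE x : u x = 1 - M^-1 * h x by [].
have uA : u \in @metric_algebra R X by rewrite rpredB ?rpred1 ?rpredZ.
have u0 x : 0 <= u x by rewrite uE subr_ge0 ler_pdivrMl// mulr1.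
(* On the empty space all functions are equal. *)
have [[x0 _]|X0] := pselect (exists x : X, True); last first.
  suff -> : (fun x => (h x)^-1 : C) = h by [].
  by apply/funext => x; exfalso; apply: X0; exists x.
pose q : C := 1 - M^-1 * e.
have q1 : q < 1 by rewrite ltrBlDr ltrDl mulr_gt0 ?invr_gt0.
have uq x : u x <= q by rewrite uE lerD2l lerN2 ler_pM2l ?invr_gt0.
have q0 : 0 <= q by exact: le_trans (uq x0).
apply: ((uniform_closedP _).1 (cstar_closed cA)).
move=> d d0; have [n qn] := complex_expr_small q0 q1 (mulr_gt0 d0 e0).
exists (M^-1 *: \sum_(i < n) u ^+ i).
  by rewrite /= rpredZ// rpred_sum// => i _; rewrite rpredX.
move=> x.
have -> : (M^-1 *: \sum_(i < n) u ^+ i) x = M^-1 * \sum_(i < n) u x ^+ i.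
  rewrite /GRing.scale/= fct_sumE; congr (_ * _); apply: eq_bigr => i _.
  by elim: (nat_of_ord i) => // m IH; rewrite !exprS -IH.
have -> : (h x)^-1 - M^-1 * \sum_(i < n) u x ^+ i = u x ^+ n / h x.
  have hx0 : h x != 0 by rewrite gt_eqF.
  apply: (mulIf hx0); rewrite mulfVK// mulrBl mulVf//.
  have -> : M^-1 * (\sum_(i < n) u x ^+ i) * h x =
            - ((u x - 1) * \sum_(i < n) u x ^+ i).
    by rewrite uE [1 - _]addrC addrK mulNr opprK mulrAC.
  by rewrite -subrX1 opprK addrC subrK.
rewrite normrM normrX normrV ?unitfE ?gt_eqF// !ger0_norm// ?ltW//.
rewrite ltr_pdivrMr//; apply: (@le_lt_trans _ _ (q ^+ n)).
  by rewrite lerXn2r// nnegrE.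
by apply: lt_le_trans qn _; rewrite ler_pM2l.
Qed.

HB.instance Definition _ (w : metric_compactification X) :=
  GRing.isLinear.Build _ _ _ _ (character_fun w) (character_linear w).

Lemma character1 (w : metric_compactification X) : w 1 = 1.
Proof.
have [f wf] := character_neq0 w; apply: (mulfI wf).
by rewrite -character_mul !mulr1.
Qed.

Definition conj_fun (f : metric_function X) : metric_function X :=
  exist _ (fun x => conjc (val f x) : C)
    (cstar_conj cstar_subalgebra_metric_algebra (valP f)).

(** The element [h = \sum_(f <- fs) `|f - w f| ^+ 2] of the algebra is a sum of
    multiples of the [f - w f], so [w h = 0] and [h] is not invertible.
    Only the linearity and multiplicativity of [w] enter; its compatibility with
    conjugation is then a consequence ([character_conj]). *)
Lemma character_approx (w : metric_compactification X)
    (fs : seq (metric_function X)) (e : C) : 0 < e ->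
  exists x, forall f, f \in fs -> `|val f x - w f| < e.
Proof.
move=> e0; apply: contrapT => nx.
pose g (f : metric_function X) : metric_function X :=
  f - w f *: (1 : metric_function X).
pose h : metric_function X := \sum_(f <- fs) g f * conj_fun (g f).
have wh : w h = 0.
  rewrite /h linear_sum big1_seq//= => f _.
  by rewrite character_mul linearB linearZ /= character1 /GRing.scale/= mulr1
    subrr mul0r.
have hE x : val h x = \sum_(f <- fs) `|val f x - w f| ^+ 2.
  rewrite -[LHS]/(point_eval x h) linear_sum; apply: eq_bigr => f _.
  have gx : val (g f) x = val f x - w f.
    by rewrite -[LHS]/(val f x - w f * 1) mulr1.
  by rewrite -gx sqr_normc [LHS]character_mul.
have he x : e ^+ 2 <= val h x.
  have [f fs_f fe] : exists2 f, f \in fs & e <= `|val f x - w f|.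
    apply: contrapT => nf; apply: nx; exists x => f fs_f.
    rewrite real_ltNge ?normr_real ?(gtr0_real e0)//; apply/negP => fe.
    by apply: nf; exists f.
  rewrite hE (big_rem f)//= (@le_trans _ _ (`|val f x - w f| ^+ 2))//.
    by rewrite lerXn2r// nnegrE ltW.
  by rewrite lerDl sumr_ge0// => i _; rewrite exprn_ge0.
have e20 : 0 < e ^+ 2 by exact: exprn_gt0.
pose k : metric_function X := exist _ (fun x => (val h x)^-1 : C)
  (metric_algebra_inv (valP h) e20 he).
have hk : h * k = 1.
  apply: val_inj; apply/funext => x /=.
  by rewrite /GRing.mul/= mulfV// gt_eqF// (lt_le_trans _ (he x)).
have /eqP := character1 w.
by rewrite -hk character_mul wh mul0r eq_sym oner_eq0.
Qed.

Lemma character_conj (w : metric_compactification X) (f : metric_function X) :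
  w (conj_fun f) = conjc (w f).
Proof.
apply/eqP; rewrite -subr_eq0 -normr_le0; apply/ler_addgt0Pl => e e0.
rewrite addr0; have e2 : 0 < e / 2%:R by rewrite divr_gt0.
have [x fx] := character_approx w [:: f; conj_fun f] e2.
have := fx f (mem_head _ _); have := fx (conj_fun f).
rewrite inE mem_head orbT => /(_ isT) fx1 fx2.
have -> : w (conj_fun f) - conjc (w f) =
    conjc (val f x - w f) - (val (conj_fun f) x - w (conj_fun f)).
  rewrite -[val (conj_fun f) x]/(conjc (val f x)) rmorphB opprB.
  by rewrite [RHS]addrC addrA subrK.
rewrite [leRHS](splitr e) (le_trans (ler_normB _ _))// lerD ?ltW//.
by rewrite normcJ.
Qed.

Lemma character_norm_le (w : metric_compactification X) (f : metric_function X)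
    (M : C) : (forall x, `|val f x| <= M) -> `|w f| <= M.
Proof.
move=> fM; apply/ler_addgt0Pl => e e0.
have [x /(_ f (mem_head _ _))] := character_approx w [:: f] e0.
rewrite distrC => fx; rewrite -(subrK (val f x) (w f)).
by rewrite (le_trans (ler_normD _ _))// lerD// ltW.
Qed.

End characters.

(** * Points of the metric boundary *)

Section boundary.
Context {R : realType} {X : metricType R}.
Local Notation C := (R[i]^o).

(** The topology of the compactification is that of pointwise convergence on the
    algebra, restated here with the norm. *)
Lemma compactification_cvg (F : set_system (metric_compactification X))
    (w : metric_compactification X) : Filter F ->
  (forall f (e : C), 0 < e ->
    \forall v \near F, `|w f - character_fun v f| < e) ->
  F --> w.
Proof.
move=> FF Fw A; rewrite nbhsE => -[B [[W Wopen <-] Ww] BA].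
suff : (@character_fun R X : metric_compactification X ->
        {ptws metric_function X -> C}) @ F -->
       (character_fun w : {ptws metric_function X -> C}).
  move=> /(_ W)/= FW; apply: (@filterS _ F FF _ _ BA); apply: FW.
  exact: open_nbhs_nbhs.
apply/cvg_sup => f; apply/cvg_image.
  by rewrite eqEsubset; split=> v // _; exists (cst v).
suff : (fun v : metric_compactification X => v f : C) @ F --> (w f : C).
  apply: cvg_trans => V /= FV; exists (@^~ f @^-1` V) => //.
  by rewrite eqEsubset; split=> [c [p + <-]//|c Vc]; exists (fun=> c).
by apply/cvgrPdist_lt => e /Fw; apply.
Qed.

Lemma dist_diff_generator (y z : X) : metric_generators (dist_diff y z).
Proof. by right; exists y => //; exists z. Qed.

Definition dist_diff_fun (y z : X) : metric_function X :=
  exist _ (dist_diff y z) (metric_generators_algebra (dist_diff_generator y z)).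

Section limit_algebra.
Variables (I : Type) (F : set_system I) (g : I -> X).
Variable w : metric_compactification X.
Hypothesis FF : Filter F.

Definition converging_functions : set (X -> C) :=
  [set h | exists2 f : metric_function X, val f = h &
    forall e : C, 0 < e -> \forall i \near F, `|w f - val f (g i)| < e].

(** Closure under products and conjugation uses that [w] is multiplicative and
    commutes with conjugation; closure under uniform limits that it is
    contracting. *)
Lemma converging_cstar_subalgebra : cstar_subalgebra converging_functions.
Proof.
split.
- move=> _ [f <- _].
  exact: cstar_sub cstar_subalgebra_metric_algebra _ (valP f).
- move=> k _ _ [f1 <- cf1] [f2 <- cf2]; exists (k *: f1 + f2) => // e e0.
  have e2 : 0 < e / 2%:R by rewrite divr_gt0.
  have k1 : 0 < `|k| + 1 by rewrite ltr_wpDl.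
  have ek : 0 < e / 2%:R / (`|k| + 1) by rewrite divr_gt0.
  near=> i.
  have -> : w (k *: f1 + f2) - val (k *: f1 + f2) (g i) =
      k * (w f1 - val f1 (g i)) + (w f2 - val f2 (g i)).
    by rewrite linearD linearZ mulrBr addrACA -opprD.
  rewrite [ltRHS](splitr e); apply: le_lt_trans (ler_normD _ _) _.
  apply: ler_ltD; last by near: i; exact: cf2.
  rewrite normrM; apply: (@le_trans _ _ ((`|k| + 1) * (e / 2%:R / (`|k| + 1)))).
    apply: ler_pM => //; first by rewrite lerDl.
    by apply: ltW; near: i; exact: cf1.
  by rewrite mulrC divfK// gt_eqF.
- move=> _ _ [f1 <- cf1] [f2 <- cf2]; exists (f1 * f2) => // e e0.
  have e2 : 0 < e / 2%:R by rewrite divr_gt0.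
  have /bounded_continuousP[_ [M M0 f1M]] :=
    cstar_sub cstar_subalgebra_metric_algebra (valP f1).
  have k1 : 0 < `|w f2| + 1 by rewrite ltr_wpDl.
  have eM : 0 < e / 2%:R / M by rewrite divr_gt0.
  have ek : 0 < e / 2%:R / (`|w f2| + 1) by rewrite divr_gt0.
  near=> i.
  have -> : w (f1 * f2) - val (f1 * f2) (g i) =
      val f1 (g i) * (w f2 - val f2 (g i)) + (w f1 - val f1 (g i)) * w f2.
    rewrite character_mul -[val (f1 * f2) _]/(val f1 (g i) * val f2 (g i)).
    by rewrite mulrBr mulrBl [RHS]addrC addrA subrK.
  rewrite [ltRHS](splitr e); apply: le_lt_trans (ler_normD _ _) _.
  apply: ltr_leD.
    rewrite normrM; apply: (@lt_le_trans _ _ (M * (e / 2%:R / M))).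
      by rewrite ltr_pM//; near: i; exact: cf2.
    by rewrite mulrC divfK// gt_eqF.
  rewrite normrM.
  apply: (@le_trans _ _ (e / 2%:R / (`|w f2| + 1) * (`|w f2| + 1))).
    apply: ler_pM => //; last by rewrite lerDl.
    by apply: ltW; near: i; exact: cf1.
  by rewrite divfK// gt_eqF.
- move=> _ [f <- cf]; exists (conj_fun f) => // e e0; near=> i.
  rewrite character_conj -[val (conj_fun f) _]/(conjc (val f (g i))).
  by rewrite -rmorphB normcJ; near: i; exact: cf.
- apply/uniform_closedP => h hgood.
  have hA : h \in @metric_algebra R X.
    apply: ((uniform_closedP _).1
      (cstar_closed (@cstar_subalgebra_metric_algebra R X))) => e e0.
    by have [_ [f <- _] hf] := hgood e e0; exists (val f) => //; exact: valP.
  pose hm : metric_function X := exist _ h hA.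
  exists hm => // e e0.
  have e3 : 0 < e / 3%:R by rewrite divr_gt0.
  have [_ [f <- cf] hf] := hgood _ e3.
  near=> i.
  have -> : w hm - val hm (g i) = w (hm - f) + (w f - val f (g i)) -
      (val hm (g i) - val f (g i)).
    by rewrite linearB addrA subrK opprB addrA subrK.
  rewrite [ltRHS]split_third.
  apply: le_lt_trans (ler_normB _ _) _; apply: ltrD; last exact: hf.
  apply: le_lt_trans (ler_normD _ _) _; apply: ler_ltD.
    by apply: character_norm_le => x; apply: ltW; exact: hf.
  by near: i; exact: cf.
Unshelve. all: by end_near. Qed.

Lemma point_eval_cvg :
  (forall f : metric_function X, vanishing_at_infinity (val f) -> w f = 0) ->
  (forall K : set X, compact K -> \forall i \near F, ~ K (g i)) ->
  (forall (y z : X) (e : C), 0 < e -> \forall i \near F,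
    `|w (dist_diff_fun y z) - val (dist_diff_fun y z) (g i)| < e) ->
  point_eval (g i) @[i --> F] --> w.
Proof.
move=> w0 gK gd.
suff conv : [set h | h \in @metric_algebra R X] `<=` converging_functions.
  apply: compactification_cvg => f e e0.
  by have [f' /val_inj -> cf] := conv _ (valP f); exact: cf.
move=> f0; rewrite /= inE; apply; split.
  exact: converging_cstar_subalgebra.
move=> h hgen.
pose hm : metric_function X := exist _ h (metric_generators_algebra hgen).
exists hm => // e e0.
case: (hgen) => [[hv|[c _ hc]]|[y _ [z _ hyz]]].
+ rewrite w0//; have [_ /(_ e e0)[K cK hK]] := hv.
  near=> i; rewrite sub0r normrN; apply: hK.
  by near: i; exact: gK.
+ near=> i.
  have -> : hm = c *: (1 : metric_function X).
    apply: val_inj => /=; rewrite -hc; apply/funext => x.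
    by rewrite -[RHS]/(c * 1) mulr1.
  rewrite linearZ /= character1.
  by rewrite -[ltLHS]/(`|c * 1 - c * 1|) subrr normr0.
+ suff -> : hm = dist_diff_fun y z by exact: gd.
  by apply: val_inj; rewrite /= -hyz.
Unshelve. all: by end_near. Qed.

End limit_algebra.

Hypothesis Xdiscrete : forall x : X, nbhs x [set x].

Lemma discrete_continuous (f : X -> C) : continuous f.
Proof.
apply/continuous_normP => x e e0; apply: filterS (Xdiscrete x) => _ ->.
by rewrite subrr normr0.
Qed.

Lemma discrete_compact_seq (K : set X) : compact K ->
  exists s : seq X, forall x, K x -> x \in s.
Proof.
move=> /compact_near_coveringP cK.
(* Compactness is applied to the filter of finite sequences ordered by
   inclusion: near each point, large sequences contain all the points. *)
pose F : set_system (seq X) :=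
  filter_from setT (fun s0 : seq X => [set s : seq X | {subset s0 <= s}]).
have FF : Filter F.
  apply: filter_from_filter; first by exists [::].
  move=> s1 s2 _ _; exists (s1 ++ s2) => // s s12.
  by split=> x xs; apply: s12; rewrite mem_cat xs ?orbT.
have [s _ /(_ s (fun _ => id)) Ks] :
    \forall s \near F, K `<=` [set x | x \in s].
  apply: (cK _ F (fun s x => x \in s)) => x Kx.
  exists ([set x], [set s : seq X | x \in s]) => [|[_ s] [/= -> //]].
  split; first exact: Xdiscrete.
  by exists [:: x] => // s; apply; exact: mem_head.
by exists s.
Qed.

Definition point_mass (x : X) : X -> C := fun y => (y == x)%:R.

Lemma point_mass_vanishing (x : X) : vanishing_at_infinity (point_mass x).
Proof.
split; first exact: discrete_continuous.
move=> e e0; exists [set x]; first exact: compact_set1.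
by move=> y yx; rewrite /point_mass; case: eqP => // _; rewrite normr0.
Qed.

Definition point_mass_fun (x : X) : metric_function X :=
  exist _ (point_mass x)
    (metric_generators_algebra
      (or_introl (or_introl (point_mass_vanishing x)))).

(** Any [f] satisfies [f * d = f x *: d], with [d] the point mass at [x].  So if
    [w d] is nonzero, then [w f = f x] for every [f], and [w] is the evaluation
    at [x]. *)
Lemma boundary_point_mass (w : metric_compactification X) (x : X) :
  metric_boundary w -> w (point_mass_fun x) = 0.
Proof.
move=> wb; apply: contrapT => /eqP wx0; apply: wb; exists x => //.
have wE f : w f = val f x.
  apply: (mulIf wx0); rewrite -character_mul -[val f x * _]/(val f x *: _).
  rewrite -linearZ; congr (w _); apply: val_inj; apply/funext => y /=.
  rewrite /GRing.scale /= /GRing.mul /= /point_mass.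
  rewrite -[RHS]/(val f x * (y == x)%:R).
  by case: eqP => [->|_]; rewrite ?mulr0.
case: w wx0 wE => w wl wm wn _ wE.
have {}wE : (fun f : metric_function X => val f x : C) = w.
  by apply/funext => f; exact/esym/wE.
rewrite /point_eval; case: _ / wE in wl wm wn *.
by congr Character; exact: Prop_irrelevance.
Qed.

(** Approximating [w] on [f] and on the point masses of a finite set [K] off
    which [f] is small gives a point outside [K] at which [f] is close to
    [w f]. *)
Lemma boundary_vanishing (w : metric_compactification X)
    (f : metric_function X) :
  metric_boundary w -> vanishing_at_infinity (val f) -> w f = 0.
Proof.
move=> wb [_ fv]; apply/eqP; rewrite -normr_le0; apply/ler_addgt0Pl => e e0.
rewrite addr0; have e2 : 0 < e / 2%:R by rewrite divr_gt0.
have [K cK fK] := fv _ e2; have [s Ks] := discrete_compact_seq cK.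
(* The masses are scaled by [e / 2], so that a single tolerance both keeps [y]
   out of [s] and bounds the error on [f]. *)
pose bump x : metric_function X := (e / 2%:R) *: point_mass_fun x.
have [y ys] := character_approx w (f :: map bump s) e2.
have /fK fy : ~ K y.
  move=> /Ks sy; have /ys : bump y \in f :: map bump s.
    by rewrite inE map_f ?orbT.
  have -> : w (bump y) = 0.
    rewrite /bump linearZ /= (boundary_point_mass _ wb).
    by rewrite -[LHS]/(e / 2%:R * 0) mulr0.
  rewrite subr0 -[val (bump y) y]/(e / 2%:R * (y == y)%:R) eqxx mulr1.
  by rewrite ger0_norm ?ltxx// ltW.
have /ys : f \in f :: map bump s by exact: mem_head.
rewrite distrC => wfy; rewrite -(subrK (val f y) (w f)) [leRHS](splitr e).
by rewrite (le_trans (ler_normD _ _))// lerD// ltW.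
Qed.

End boundary.

(** * Geodesics of Cayley graphs of abelian groups *)

(** Choose each index so as to minimize [u] over all the indices that remain
    available. *)
Lemma nondecreasing_subseq (u : nat -> nat) :
  exists f : nat -> nat, {homo f : m n / (m < n)%N} /\
    {homo u \o f : m n / (m <= n)%N}.
Proof.
have argmin m : exists k, (m <= k)%N /\ forall l, (m <= l)%N -> (u k <= u l)%N.
  have hP : exists v, `[< exists2 k, (m <= k)%N & u k = v >].
    by exists (u m); apply/asboolP; exists m.
  case: (ex_minnP hP) => v /asboolP[k mk <-] vmin; exists k; split=> // l ml.
  by apply: vmin; apply/asboolP; exists l.
have [g gP] := choice argmin.
pose f := fix f n := if n is k.+1 then g (f k).+1 else g 0%N.
have fS n : (f n < f n.+1)%N by have [] := gP (f n).+1.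
have flt : {homo f : m n / (m < n)%N}.
  exact: homo_ltn ltn_trans fS.
exists f; split=> //; apply: homo_leq => // [|[|n]] /=.
- exact: leq_trans.
- by have [_] := gP 0%N; apply.
- by have [_] := gP (f n).+1; apply; exact: ltn_trans (fS n) (fS n.+1).
Qed.

(** Dickson's lemma: the coordinatewise order on vectors of natural numbers
    indexed by a finite set is a well-quasi-order.  Coordinates are treated one
    after the other, as a subsequence of a nondecreasing sequence is
    nondecreasing. *)
Lemma dickson_subseq (T : eqType) (s : seq T) (a : nat -> T -> nat) :
  exists f : nat -> nat, {homo f : m n / (m < n)%N} /\
    forall c, c \in s -> {homo (fun n => a (f n) c) : m n / (m <= n)%N}.
Proof.
elim: s => [|c s [f [flt fs]]]; first by exists id; split.
have [g [glt gc]] := nondecreasing_subseq (fun n => a (f n) c).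
exists (f \o g); split=> [m n mn|b]; first by apply: flt; exact: glt.
rewrite inE => /orP[/eqP ->|bs]; first exact: gc.
move=> m n mn /=; apply: (fs b bs); exact: (ltnW_homo glt).
Qed.

Section cayley_words.
Context {G : zmodType} {S : {fset G}}.
Hypotheses (Ssym : symmetric_fset S) (Sgen : generates S).

Local Notation dist := (graph_dist (cayley_edge S)).

Definition word (x : G) (p : seq G) : Prop :=
  {subset p <= S} /\ \sum_(s <- p) s = x.

Lemma cayley_edge_step (x y : G) : cayley_edge S x y = (y - x \in S).
Proof.
rewrite /cayley_edge; apply/orb_idr => xyS.
rewrite -opprB -Ssym; apply/imfsetP.
by exists (x - y).
Qed.

Lemma walk_word (x y : G) n :
  walk (cayley_edge S) x y n <-> exists2 p, word (y - x) p & size p = n.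
Proof.
split=> [[p [xp <- <-]]|[p [pS pyx] <-]].
  elim: p x xp => [|z p IH] x /= => [_|/andP[xz /IH[q [qS qz] <-]]].
    by exists [::]; split=> //; rewrite big_nil subrr.
  rewrite cayley_edge_step in xz.
  exists (z - x :: q) => //; split; last first.
    by rewrite big_cons qz addrC addrA subrK.
  by move=> s; rewrite inE => /orP[/eqP -> //|/qS].
have -> : y = x + \sum_(s <- p) s by rewrite pyx addrC subrK.
elim: p pS x {y pyx} => [|s p IH] pS x.
  by exists [::]; split; rewrite // big_nil addr0.
have [|q [xq qy qp]] := IH _ (x + s).
  by move=> t tp; apply: pS; rewrite inE tp orbT.
exists (x + s :: q); rewrite /= qp; split=> //.
  by rewrite xq cayley_edge_step [x + s]addrC addrK pS ?mem_head.
by rewrite qy big_cons addrA.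
Qed.

Lemma dist_word_le (x : G) (p : seq G) (y : G) :
  word (y - x) p -> (dist x y <= size p)%N.
Proof.
move=> yxp; have [_] := graph_distP (cayley_connected Sgen x y); apply.
by apply/walk_word; exists p.
Qed.

Lemma geodesic_word (x : G) : exists2 p, word x p & size p = dist 0%R x.
Proof.
have [/walk_word[p px <-] _] := graph_distP (cayley_connected Sgen 0 x).
by exists p => //; rewrite subr0 in px.
Qed.

(** This is where commutativity is used: inclusion of multisets of letters, and
    not only inclusion as a prefix, suffices for [x] to lie on a geodesic from
    [0] to [y]. *)
Lemma geodesic_word_cat (x y : G) (p q : seq G) :
  word x p -> size p = dist 0%R x -> word y q -> size q = dist 0%R y ->
  (forall s, s \in S -> (count_mem s p <= count_mem s q)%N) ->
  (dist 0%R x + dist x y = dist 0%R y)%N.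
Proof.
move=> [pS px] px_size [qS qy] qy_size pq.
have /count_subseqP[p' p'q pp'] s : (count_mem s p <= count_mem s q)%N.
  have [/pq //|sS] := boolP (s \in S).
  by rewrite (count_memPn _) //; apply: contra sS => /pS.
have [r qr] := perm_to_subseq p'q.
have {}qr : perm_eq q (p ++ r).
  by rewrite (perm_trans qr)// perm_cat2r perm_sym.
apply/eqP; rewrite eqn_leq (graph_dist_triangle (cayley_connected Sgen)) andbT.
rewrite -px_size -[dist 0%R y]qy_size (perm_size qr) size_cat leq_add2l.
apply: dist_word_le; split.
  by move=> s sr; apply: qS; rewrite (perm_mem qr) mem_cat sr orbT.
by rewrite -qy (perm_big _ qr) big_cat /= px addrC addrK.
Qed.

Lemma geodesic_chain (x : nat -> G) : exists f : nat -> nat,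
  {homo f : m n / (m < n)%N} /\
  forall m n, (m <= n)%N ->
    (dist 0%R (x (f m)) + dist (x (f m)) (x (f n)) = dist 0%R (x (f n)))%N.
Proof.
have /choice[p pP] n : exists p, word (x n) p /\ size p = dist 0%R (x n).
  by have [q] := geodesic_word (x n); exists q.
have [f [flt fS]] := dickson_subseq S (fun n s => count_mem s (p n)).
exists f; split=> // m n mn.
have [pm pm_size] := pP (f m); have [pn pn_size] := pP (f n).
by apply: geodesic_word_cat pm pm_size pn pn_size _ => s /fS; apply.
Qed.

Fixpoint ball_seq n : seq G :=
  if n is m.+1 then ball_seq m ++ [seq x + s | x <- ball_seq m, s <- S]
  else [:: 0].

Lemma mem_ball_seq n x : (dist 0%R x <= n)%N -> x \in ball_seq n.
Proof.
have [p [pS <-] <-] := geodesic_word x.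
elim/last_ind: p n pS => [|p s IH] n pS.
  move=> _; rewrite big_nil.
  by elim: n => [|n IH] //=; rewrite ?inE// mem_cat IH.
rewrite size_rcons; case: n => // n; rewrite ltnS => pn /=.
rewrite mem_cat big_rcons; apply/orP; right; apply/allpairsP.
exists (\sum_(i <- p) i, s); split=> //=; last first.
  by apply: pS; rewrite mem_rcons mem_head.
by apply: IH => // t tp; apply: pS; rewrite mem_rcons inE tp orbT.
Qed.

End cayley_words.

(** * Boundary points of Cayley graphs *)

Section cayley_boundary.
Variables (R : realType) (G : zmodType) (S : {fset G}).
Variables (Ssym : symmetric_fset S) (Sgen : generates S).
Local Notation X := (cayley_space R Ssym Sgen).
Local Notation C := (R[i]^o).
Local Notation dist := (graph_dist (cayley_edge S)).

Lemma mdistE (x y : X) : mdist x y = (dist x y)%:R.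
Proof. by []. Qed.

Lemma cayley_discrete (x : X) : nbhs x [set x].
Proof.
have := nbhsx_ballx x 1 ltr01; rewrite ballEmdist; apply: filterS => y /=.
rewrite mdistE ltrn1 ltnS leqn0 => /eqP d0; apply/esym.
exact: (graph_dist0_eq (cayley_connected Sgen)).
Qed.

(** Finiteness of balls allows approximating [w] on the data of a whole ball at
    once.  The tolerance [2^-1 ^+ n] tends to zero, and is at most one: the
    value [1] of a point mass at its own point is thus ruled out, which keeps
    [x] outside the ball. *)
Lemma boundary_approx (w : metric_compactification X) (n : nat) :
  metric_boundary w ->
  exists x : X, (n < dist 0%R x)%N /\
    forall y z : X, (dist 0%R y <= n)%N -> (dist 0%R z <= n)%N ->
      `|w (dist_diff_fun y z) - val (dist_diff_fun y z) x| < 2^-1 ^+ n.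
Proof.
move=> wb.
have e0 : 0 < 2^-1 ^+ n :> C by rewrite exprn_gt0// invr_gt0.
pose b : seq X := @ball_seq G S n.
pose fs := [seq dist_diff_fun y z | y <- b, z <- b] ++
  [seq point_mass_fun cayley_discrete y | y <- b].
have [x xfs] := character_approx w fs e0; exists x; split.
  rewrite ltnNge; apply/negP => /(mem_ball_seq Ssym Sgen) xb.
  have /xfs : point_mass_fun cayley_discrete x \in fs.
    by rewrite mem_cat [X in _ || X]map_f ?orbT.
  rewrite boundary_point_mass// subr0 /= /point_mass eqxx normr1.
  rewrite real_ltNge ?real1 ?gtr0_real//.
  by rewrite exprn_ile1 ?invr_ge0 ?invf_le1 ?ler1n.
move=> y z /(mem_ball_seq Ssym Sgen) yb /(mem_ball_seq Ssym Sgen) zb.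
rewrite distrC; apply: xfs; rewrite mem_cat; apply/orP; left.
by apply/allpairsP; exists (y, z).
Qed.

(** Points of a geodesic chain from [0] are at distance the difference of their
    parameters, which makes the error in the almost-geodesic condition vanish.
    The ray leaves every compact set because these are finite. *)
Lemma boundary_busemann (w : metric_compactification X) :
  metric_boundary w -> busemann_point w.
Proof.
move=> wb; split=> //.
have /choice[x xP] n := boundary_approx n wb.
have [f [flt fd]] := geodesic_chain Ssym Sgen x.
pose len n := dist 0%R (x (f n)).
have fn n : (n <= f n)%N.
  by elim: n => // n IH; apply: leq_ltn_trans IH _; exact: flt.
have lenn n : (n < len n)%N by apply: leq_ltn_trans (fn n) (xP _).1.
have len_homo m n : (m <= n)%N -> (len m <= len n)%N.
  by move=> /fd mn; rewrite /len -mn leq_addr.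
(* The parameter of a point is its distance to the origin.  As [x (f n)] is
   never the origin, the parameter [0] falls on the default value [o]. *)
pose T : set R := [set t | t = 0 \/ exists n, t = (len n)%:R].
pose o : X := (0 : G).
pose g (t : R) : X :=
  xget o [set u | exists2 n, u = x (f n) & t = (len n)%:R].
have g0 : g 0 = o.
  rewrite /g; case: xgetP => // u _ [n _] /eqP.
  by rewrite eq_sym pnatr_eq0 => /eqP l0; have := lenn n; rewrite l0.
have gT t : T t -> t = 0 \/ exists2 n, g t = x (f n) & t = (len n)%:R.
  move=> [->|[n tn]]; [by left|right; rewrite /g].
  by case: xgetP => [u _ []|/(_ (x (f n)))[]]; [move=> m; exists m|exists n].
have gd t : T t -> mdist o (g t) = t.
  move=> /gT[->|[n -> ->]]; last exact: mdistE.
  by rewrite g0 mdistxx.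
exists T, g; split.
  split=> [t||[B TB]|e e0].
  - by move=> [->|[n ->]] /=.
  - by left.
  - have /TB : T (len (Num.truncn `|B|))%:R.
      by right; exists (Num.truncn `|B|).
    apply/negP; rewrite -ltNge (le_lt_trans (ler_norm B))//.
    by rewrite (lt_le_trans (truncnS_gt _))// ler_nat.
  - exists 0 => t s Tt Ts st _.
    suff -> : mdist (g t) (g s) + mdist (g s) (g 0) = t by rewrite subrr normr0.
    rewrite g0 [mdist (g s) _]metric_sym gd//.
    have [s0|[m gm sm]] := gT s Ts.
      by rewrite s0 g0 addr0 metric_sym gd.
    have [t0|[n gn tn]] := gT t Tt.
      move: st; rewrite t0 sm lern0 => /eqP l0.
      by have := lenn m; rewrite l0.
    rewrite gm gn mdistE sm tn -natrD; congr (_%:R).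
    have lmn : (len m <= len n)%N by rewrite -(ler_nat R) -sm -tn.
    have [mn|/ltnW nm] := leqP m n.
      rewrite addnC.
      rewrite (graph_distC (@cayley_edge_sym _ S) (cayley_connected Sgen)).
      exact: fd.
    (* [m] and [n] may be in the wrong order only if the lengths agree, and then
       the two points coincide. *)
    have := fd _ _ nm; rewrite -/(len n) -/(len m) => nm'.
    have := lmn; rewrite -{1}nm' -{2}[len n]addn0 leq_add2l leqn0 => /eqP d0.
    by rewrite d0 add0n -nm' d0 addn0.
apply: point_eval_cvg.
- by move=> h hv; apply: boundary_vanishing wb hv; exact: cayley_discrete.
- move=> K /(discrete_compact_seq cayley_discrete)[s Ks].
  have [B sB] : exists B : nat, forall y, y \in s -> (dist 0%R y <= B)%N.
    elim: s {Ks} => [|y s [B sB]]; first by exists 0%N.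
    exists (maxn (dist 0%R y) B) => z; rewrite inE => /orP[/eqP ->|/sB zB].
      exact: leq_maxl.
    by rewrite (leq_trans zB)// leq_maxr.
  exists B%:R; split => // t Bt Tt /Ks /sB.
  by rewrite -(ler_nat R) -mdistE gd// leNgt Bt.
- move=> y z e e0.
  have [||n0 n0e] := @complex_expr_small R 2^-1 e _ _ e0.
    by rewrite invr_ge0.
    by rewrite invf_lt1// ltr1n.
  pose N := maxn n0 (maxn (dist 0%R y) (dist 0%R z)).
  exists (len N)%:R; split => // t lt Tt.
  have [t0|[n gn tn]] := gT t Tt; first by move: lt; rewrite t0 ltrn0.
  have Nn : (N <= f n)%N.
    apply: leq_trans (fn n); rewrite leqNgt; apply/negP => /ltnW/len_homo.
    by rewrite leqNgt -(ltr_nat R) -tn lt.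
  move: Nn; rewrite !geq_max gn => /and3P[n0n yn zn].
  apply: lt_trans ((xP (f n)).2 y z yn zn) _; apply: le_lt_trans n0e.
  by rewrite ler_wiXn2l ?invr_ge0 ?invf_le1 ?ler1n.
Qed.

End cayley_boundary.

Theorem proposition3p5 (R : realType) (G : zmodType) (S : {fset G})
  (Ssym : symmetric_fset S) (Sgen : generates S)
  (w : metric_compactification (cayley_space R Ssym Sgen)) :
  metric_boundary w -> busemann_point w.
Proof. exact: boundary_busemann. Qed.
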